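(* For $a,b\in\mathbb{C}$ consider the $2$-periodic Lyness recurrence $$x_{n+2}=\frac{a_n+x_{n+1}}{x_n},\qquad a_n=\begin{cases}a & \text{for } n=2\ell+1,\\ b & \text{for } n=2\ell,\end{cases}$$ with initial conditions $x_1,x_2$. The only globally periodic recurrences in this family are: (i) the cases $a=b=0$ (globally $6$-periodic) and $a=b=1$ (globally $5$-periodic); (ii) the cases $a=(-1\pm i\sqrt{3})/2$ and $b=\overline{a}=1/a$, which are globally $10$-periodic.
   Context: A recurrence (autonomous or not) is globally $p$-periodic if for all (complex) initial conditions for which the sequence $\{x_n\}$ is well defined, the sequence is $p$-periodic ($x_{n+p}=x_n$ for all $n$), and $p$ is the smallest positive integer with this property. It is globally periodic if it is globally $p$-periodic for some $p$. *)

(* Defs.v *)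
From mathcomp Require Import all_boot all_order all_algebra.
From mathcomp Require Import reals complex.

Set Implicit Arguments.
Unset Strict Implicit.
Unset Printing Implicit Defensive.

Import GRing.Theory Num.Theory.

Local Open Scope ring_scope.

(* Sequences are indexed from 1: the value at index 0 is never constrained.
   In the three definitions below, S is the set of the well-defined solutions
   of a recurrence, one for each admissible choice of initial conditions. *)

Definition all_periodic (T : Type) (S : (nat -> T) -> Prop) (p : nat) : Prop :=
  forall x : nat -> T, S x -> forall n : nat, (0 < n)%N -> x (n + p)%N = x n.

Definition globally_p_periodic (T : Type) (S : (nat -> T) -> Prop) (p : nat) :
    Prop :=
  [/\ (0 < p)%N, all_periodic S p
    & forall q : nat, (0 < q)%N -> all_periodic S q -> (p <= q)%N].

Definition globally_periodic (T : Type) (S : (nat -> T) -> Prop) : Prop :=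
  exists p : nat, globally_p_periodic S p.

Section Lyness.
Variable C : fieldType.

Definition lyness_coef (a b : C) (n : nat) : C := if odd n then a else b.

(* Division is total, so the infinite sequence being well defined is expressed
   by the nonvanishing of every denominator x_n. The initial conditions are
   x 1 and x 2, which are otherwise arbitrary. *)
Definition lyness_solution (a b : C) (x : nat -> C) : Prop :=
  forall n : nat, (0 < n)%N ->
    x n != 0 /\ x n.+2 = (lyness_coef a b n + x n.+1) / x n.

End Lyness.

(* Main.v *)
Require Import Defs.
From mathcomp Require Import all_boot all_order all_algebra.
From mathcomp Require Import zify ring.
From mathcomp Require Import boolp classical_sets cardinality ereal measure.
From mathcomp Require Import lebesgue_measure.
From mathcomp Require Import reals complex.

Set Implicit Arguments.
Unset Strict Implicit.
Unset Printing Implicit Defensive.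

Import Order.TTheory GRing.Theory Num.Theory.

Local Open Scope ring_scope.

(* Necessity. Take x_1, x_2 to be monomials in an indeterminate u, so that the
   x_n are rational functions of u. Every second term, y_l = x_(2l+r), satisfies
   (y_(l-1) y_l - c) (y_l y_(l+1) - c) = y_l + d with {c, d} = {a, b}. If
   c^2 <> d then, at any point of the u-line, a zero y_l of order m has a
   neighbour y_(l-1) or y_(l+1) with a pole of order at least m, and the zeros
   absorbed in this way by a pole never exceed its order. Hence the orders of
   the y_l over a period add up to at most 0 at each finite point, so the sum of
   their degrees is at most 0. But the degrees in u follow the tropical
   recurrence d_(n+2) = max(0, d_(n+1)) - d_n (with d_(n+1) for the maximum when
   the coefficient vanishes), which is periodic with positive sum. So a^2 = b
   and b^2 = a. As the complex field is uncountable, some value of u avoids the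
   zeros and poles of all the x_n, so that numeric periodicity bears on the
   rational functions.
   Sufficiency. If a^2 = b, b^2 = a and a b = 1, then x_(n+5) = a_(n+1) x_n. *)

(** * Balance of zeros and poles at one point *)

(* Here v n is the order of x_n at a point and w n that of a_n + x_(n+1). *)
Section ZeroSum.
Variables (v w : nat -> int) (r : nat).
Hypothesis w_def : forall n, w n = v n + v n.+2.
Hypothesis w_neg : forall n, w n < 0 \/ v n.+1 < 0 -> w n = v n.+1.
Hypothesis res : forall l,
  ~ [/\ 0 < w (l.*2 + r)%N, 0 < v (l.*2 + r).+2 & 0 < w (l.*2 + r).+2].

Let y l := v (l.*2 + r)%N.
(* A zero goes to its right neighbour whenever that pole is large enough. *)
Let toR l : int := if (0 < y l) && (y l.+1 <= - y l) then y l else 0.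
Let toL l : int := if (0 < y l) && (- y l < y l.+1) then y l else 0.

(** A zero sends its order to one neighbour, which is then a pole, so a term that is not a pole
    receives nothing. A pole sends nothing, and what it receives is at most its own order. *)
Lemma pole_absorbs_zeros l : y l.+1 + toR l + toL l.+2 <= toR l.+1 + toL l.+1.
Proof.
(* By [res], if the right neighbour is too weak a pole to absorb the zero, the left one is strong
   enough. *)
have h0 : 0 < y l.+2 -> - y l.+2 < y l.+3 -> y l.+1 <= - y l.+2.
  have := @res l.+1; rewrite !w_def /y !doubleS !addSn => h p q.
  rewrite leNgt; apply/negP => q'; apply: h; split => //; lia.
(* Zeros on both sides of a pole: here [w n <= v n.+1] and [w n.+2 <= v n.+3], while
   [v n.+1 + v n.+3 = w n.+1 = v n.+2]. Adding these gives the bound. *)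
have h1 : y l.+1 < 0 -> 0 < y l -> y l.+1 <= - y l -> 0 < y l.+2 ->
    y l.+1 <= - y l.+2 -> y l + y l.+2 <= - y l.+1.
  rewrite /y !doubleS !addSn; set n := (l.*2 + r)%N.
  have := w_def n; have := w_def n.+1; have := w_def n.+2.
  have := @w_neg n; have := @w_neg n.+1; have := @w_neg n.+2.
  lia.
rewrite /toR /toL.
by case: ifP => ?; case: ifP => ?; case: ifP => ?; case: ifP => ?; lia.
Qed.

Lemma sum_orders_le0 (L : nat) : (forall l, y (l + L)%N = y l) ->
  \sum_(l < L) y l <= 0.
Proof.
case: L => [|L] per; first by rewrite big_ord0.
have shift (f : nat -> int) : (forall l, f (l + L.+1)%N = f l) ->
    \sum_(l < L.+1) f l.+1 = \sum_(l < L.+1) f l.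
  move=> fper; rewrite big_ord_recr [RHS]big_ord_recl /= addrC.
  by rewrite -[in f L.+1](add0n L.+1) fper.
have pR l : toR (l + L.+1)%N = toR l by rewrite /toR -addSn !per.
have pL l : toL (l + L.+1)%N = toL l by rewrite /toL -addSn !per.
have : \sum_(l < L.+1) (y l.+1 + toR l + toL l.+2) <=
       \sum_(l < L.+1) (toR l.+1 + toL l.+1).
  by apply: ler_sum => l _; apply: pole_absorbs_zeros.
rewrite !big_split /= (shift (fun l => toL l.+1)) ?(shift toL) ?(shift toR)
  ?(shift y) //.
  by rewrite -addrA gerDr.
by move=> l; rewrite -addSn pL.
Qed.
End ZeroSum.

(** * Orders of fractions through root multiplicities *)

Section Multiplicity.
Variables (F : fieldType) (c : F).
Implicit Types p q : {poly F}.

Lemma dvdp_scale (k : F) p q : p %| q -> p %| k *: q.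
Proof. by move=> pq; rewrite -mul_polyC dvdp_mull. Qed.

(** Ultrametric rule for [k + p / q]: if the sum or [p / q] has a pole at [c], the constant does not
    affect the order. This supplies [w_neg]. *)
Lemma mup_addl (k : F) p q : p != 0 -> q != 0 -> k *: q + p != 0 ->
  (mup c (k *: q + p) < mup c q)%N \/ (mup c p < mup c q)%N ->
  mup c (k *: q + p) = mup c p.
Proof.
move=> p0 q0 s0.
have E n : (n <= mup c q)%N -> (n <= mup c (k *: q + p))%N = (n <= mup c p)%N.
  by move=> nq; rewrite !mup_geq // dvdp_addr // dvdp_scale // -mup_geq.
by case=> lt; move: (E _ lt) (E _ (ltnW lt)); rewrite ltnn leqnn; lia.
Qed.

(** For [x1 = p1 / q1], [x2 = p2 / q2] and [x3 = (b + x2) / x1]: if [a + x1], [x2] and [a + x3] all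
    vanished at [c], then [x1 = x3 = - a] and [x1 * x3 = b] there, so [a ^+ 2 = b]. This supplies
    [res]. *)
Lemma residue_obstruction (a b : F) p1 q1 p2 q2 : a ^+ 2 != b ->
  p1 != 0 -> q1 != 0 -> p2 != 0 -> q2 != 0 ->
  let p3 := (b *: q2 + p2) * q1 in let q3 := q2 * p1 in
  a *: q1 + p1 != 0 -> a *: q3 + p3 != 0 ->
  (mup c q1 < mup c (a *: q1 + p1))%N -> (mup c q2 < mup c p2)%N ->
  ~~ (mup c q3 < mup c (a *: q3 + p3))%N.
Proof.
move=> ab p10 q10 p20 q20 p3 q3 s10 s30 h1 h2; apply/negP => h3.
pose d := 'X - c%:P.
have d1 : d ^+ (mup c q1).+1 %| a *: q1 + p1 by rewrite -mup_geq.
have d2 : d ^+ (mup c q2).+1 %| p2 by rewrite -mup_geq.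
have dq1 : d ^+ mup c q1 %| q1 by rewrite -mup_geq.
have dq2 : d ^+ mup c q2 %| q2 by rewrite -mup_geq.
have le1 : (mup c q1 <= mup c p1)%N.
  rewrite mup_geq // -(dvdp_addr _ (dvdp_scale a dq1)).
  by apply: dvdp_trans d1; rewrite exprS dvdp_mull.
(* Fractions may be unreduced, so evaluation at [c] is replaced by divisibility: each term of the
   identity below contains one factor [d] more than [q1 * q2] does. *)
have : d ^+ (mup c q1 + mup c q2).+1 %| q1 * q2.
  rewrite -(@dvdpZr _ (b - a ^+ 2)) ?subr_eq0 1?eq_sym //.
  have -> : (b - a ^+ 2) *: (q1 * q2) =
      (a *: q3 + p3) - (p2 * q1 + a *: (q2 * (a *: q1 + p1))).
    by rewrite /q3 /p3 -!mul_polyC; ring.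
  apply: dvdp_sub; last apply: dvdp_add.
  - apply: dvdp_trans (_ : d ^+ (mup c q3).+1 %| _); last by rewrite -mup_geq.
    by apply: dvdp_exp2l; rewrite mupM //; lia.
  - by rewrite addnC -addSn exprD dvdp_mul.
  - by rewrite dvdp_scale // addnC -addnS exprD dvdp_mul.
by rewrite -mup_geq ?mulf_neq0 // mupM // ltnn.
Qed.

End Multiplicity.

(** * From orders at all points to degrees *)

Lemma additive_prod (F : fieldType) (f : {poly F} -> nat) (I : Type) (s : seq I)
    (G : I -> {poly F}) :
  f 1 = 0%N -> (forall p q, p != 0 -> q != 0 -> f (p * q) = (f p + f q)%N) ->
  (forall i, G i != 0) -> f (\prod_(i <- s) G i) = (\sum_(i <- s) f (G i))%N.
Proof.
move=> f1 fM G0; elim: s => [|i s IHs]; first by rewrite !big_nil.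
rewrite !big_cons fM ?IHs //.
by apply: (big_ind (fun p => p != 0)) => //;
  [exact: oner_neq0|exact: mulf_neq0].
Qed.

(** Over an algebraically closed field, each linear factor of [p] is also one of [q]; cancel it from
    both and induct. *)
Lemma mup_le_size (F : closedFieldType) (p q : {poly F}) : p != 0 -> q != 0 ->
  (forall c, mup c p <= mup c q)%N -> (size p <= size q)%N.
Proof.
have [n] := ubnP (size p); elim: n p q => // n IHn p q ltpn p0 q0 le_mup.
have [/eqP sp1|/closed_rootP[c pc]] := boolP (size p == 1%N).
  by rewrite sp1 size_poly_gt0.
have cp : 'X - c%:P %| p by rewrite dvdp_XsubCl.
have cq : 'X - c%:P %| q.
  by rewrite XsubC_dvd //; apply: leq_trans (le_mup c); rewrite -XsubC_dvd.
move: cp cq => /dvdpP[p' Ep] /dvdpP[q' Eq].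
have X0 : 'X - c%:P != 0 :> {poly F} by rewrite polyXsubC_eq0.
have p'0 : p' != 0 by apply: contraNneq p0 => p'0; rewrite Ep p'0 mul0r.
have q'0 : q' != 0 by apply: contraNneq q0 => q'0; rewrite Eq q'0 mul0r.
move: ltpn le_mup; rewrite Ep Eq !size_mul ?size_XsubC ?addn2 //= !ltnS => lt le.
apply: IHn => // x; have := le x.
by rewrite !mupM // leq_add2r.
Qed.

Lemma sum_subz (L : nat) (f g : nat -> nat) :
  \sum_(l < L) ((f l)%:Z - (g l)%:Z) =
  (\sum_(l < L) f l)%N%:Z - (\sum_(l < L) g l)%N%:Z.
Proof. by rewrite sumrB !(big_morph Posz PoszD (erefl 0%:Z)). Qed.

Lemma degrees_sum_le0 (F : closedFieldType) (e : nat -> F)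
    (P Q : nat -> {poly F}) (r L : nat) :
  (forall n, e n.+2 = e n) -> e r ^+ 2 != e r.+1 ->
  (forall n, P n.+2 = (e n *: Q n.+1 + P n.+1) * Q n) ->
  (forall n, Q n.+2 = Q n.+1 * P n) ->
  (forall n, P n != 0) -> (forall n, Q n != 0) ->
  (forall n, P (n + L.*2)%N * Q n = P n * Q (n + L.*2)%N) ->
  \sum_(l < L) ((size (P (l.*2 + r)%N))%:Z - (size (Q (l.*2 + r)%N))%:Z) <= 0.
Proof.
move=> e_per e_neq PE QE P0 Q0 per.
have S0 n : e n *: Q n.+1 + P n.+1 != 0.
  by apply: contraNneq (P0 n.+2) => S0; rewrite PE S0 mul0r.
have e_evn l : e (l.*2 + r)%N = e r /\ e (l.*2 + r).+1 = e r.+1.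
  by elim: l => // l; rewrite doubleS !addSn !e_per.
have local c : \sum_(l < L)
    ((mup c (P (l.*2 + r)%N))%:Z - (mup c (Q (l.*2 + r)%N))%:Z) <= 0.
  pose v n : int := (mup c (P n))%:Z - (mup c (Q n))%:Z.
  pose w n : int := (mup c (e n *: Q n.+1 + P n.+1))%:Z - (mup c (Q n.+1))%:Z.
  apply: (@sum_orders_le0 v w).
  - by move=> n; rewrite /v /w PE QE !mupM //; lia.
  - by move=> n; rewrite /v /w !subr_lt0 !ltz_nat => h; rewrite mup_addl.
  - move=> l; have [eE oE] := e_evn l; rewrite /v /w e_per eE.
    set n := (l.*2 + r)%N; rewrite !subr_gt0 !ltz_nat => -[h1 h2 h3].
    have := S0 n; have := S0 n.+2; rewrite e_per /n eE -/n => s3 s1.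
    have := @residue_obstruction F c _ _ _ _ _ _ e_neq (P0 n.+1) (Q0 n.+1)
      (P0 n.+2) (Q0 n.+2).
    have -> : e r.+1 = e n.+1 by rewrite /n oE.
    by rewrite /= -PE -QE s1 s3 h1 h2 h3 => /(_ isT isT isT isT).
  - move=> l; rewrite /v doubleD addnAC.
    have /(congr1 (mup c)) := per (l.*2 + r)%N; rewrite !mupM //; lia.
(* The quotient [pp / qq] has no zero at any finite point, so its degree is at most 0. *)
pose pp := \prod_(l < L) P (l.*2 + r)%N; pose qq := \prod_(l < L) Q (l.*2 + r)%N.
have pp0 : pp != 0 by apply/prodf_neq0.
have qq0 : qq != 0 by apply/prodf_neq0.
have le_mup c : (mup c pp <= mup c qq)%N.
  have mup1 : mup c (1 : {poly F}) = 0%N by rewrite mupNroot // rootC oner_eq0.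
  have mupM2 : forall p q : {poly F}, p != 0 -> q != 0 ->
    mup c (p * q) = (mup c p + mup c q)%N by move=> *; rewrite mupM.
  rewrite !(additive_prod _ mup1 mupM2) //.
  have := local c.
  by rewrite (sum_subz _ (fun l => mup c (P (l.*2 + r)%N))
    (fun l => mup c (Q (l.*2 + r)%N))) subr_le0.
pose deg (p : {poly F}) := (size p).-1.
have degM p q : p != 0 -> q != 0 -> deg (p * q) = (deg p + deg q)%N.
  move=> p0 q0; rewrite /deg size_mul //.
  move: p0 q0; rewrite -!size_poly_gt0.
  by case: (size p) (size q) => [|m] [|k] //; rewrite addSn addnS.
have deg1 : deg 1 = 0%N by rewrite /deg size_poly1.
have : (deg pp <= deg qq)%N.
  by rewrite /deg -!subn1 leq_sub2r // mup_le_size.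
rewrite !(additive_prod _ deg1 degM) // => le_deg.
rewrite (eq_bigr (fun l : 'I_L =>
    (deg (P (l.*2 + r)%N))%:Z - (deg (Q (l.*2 + r)%N))%:Z)).
  by rewrite (sum_subz _ (fun l => deg (P (l.*2 + r)%N))
    (fun l => deg (Q (l.*2 + r)%N))) subr_le0.
move=> l _; move: (P0 (l.*2 + r)%N) (Q0 (l.*2 + r)%N).
rewrite /deg -!size_poly_gt0; case: (size _) (size _) => [|m] [|k] //= _ _.
by lia.
Qed.

(** * Tropical recurrence of the degrees *)

(* One step performs two iterations of the recurrence; a0 and b0 tell whether
   the coefficients a and b vanish. *)
Definition trop_step (a0 b0 : bool) (s : int * int) : int * int :=
  let x := (if a0 then s.2 else Num.max 0 s.2) - s.1 in
  (x, (if b0 then x else Num.max 0 x) - s.2).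

Definition trop_orbit (a0 b0 : bool) (s : int * int) (n : nat) : int :=
  let t := iter n./2 (trop_step a0 b0) s in if odd n then t.2 else t.1.

Lemma trop_orbitSS a0 b0 s n : let d := trop_orbit a0 b0 s in
  d n.+2 = (if (if odd n then b0 else a0) then d n.+1 else Num.max 0 (d n.+1)) - d n.
Proof.
rewrite /trop_orbit /= negbK uphalf_half.
by case: (odd n) => /=.
Qed.

Lemma iter_modn (T : Type) (f : T -> T) (x : T) k n :
  iter k f x = x -> iter n f x = iter (n %% k) f x.
Proof.
move=> fx; rewrite {1}(divn_eq n k) addnC iterD; congr (iter _ f _).
by elim: (n %/ k)%N => // m IHm; rewrite mulSn iterD IHm.
Qed.

Lemma trop_cycle (a0 b0 : bool) : ~~ (a0 && b0) ->
  exists (s : int * int) (k : nat), let d := trop_orbit a0 b0 s in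
  [/\ forall n, d n != 0, forall n, d (n + k.*2)%N = d n
    & forall r, (r < 2)%N -> 0 < \sum_(l < k) d (l.*2 + r)%N].
Proof.
(* Periodicity reduces the claims on all [n] to a computation on one finite trajectory of [k] double
   steps. *)
have main (s : int * int) k :
    let f := trop_step a0 b0 in
    (0 < k)%N -> iter k f s = s ->
    all (fun t => (t.1 != 0) && (t.2 != 0)) (traject f s k) ->
    0 < \sum_(t <- traject f s k) t.1 -> 0 < \sum_(t <- traject f s k) t.2 ->
  let d := trop_orbit a0 b0 s in
  [/\ forall n, d n != 0, forall n, d (n + k.*2)%N = d n
    & forall r, (r < 2)%N -> 0 < \sum_(l < k) d (l.*2 + r)%N].
  move=> f k0 sk /allP nz s1 s2 d; split => [n|n|r].
  - rewrite /d /trop_orbit (iter_modn _ sk).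
    have /nz/andP[n1 n2] : iter (n./2 %% k) f s \in traject f s k.
      by apply/trajectP; exists (n./2 %% k)%N; rewrite // ltn_mod.
    by case: odd.
  - rewrite /d /trop_orbit halfD oddD odd_double andbF add0n doubleK addbF.
    by rewrite iterD sk.
  - have size_tr : size (traject f s k) = k by rewrite size_traject.
    move: s1 s2; rewrite !(big_nth s) size_tr !big_mkord.
    rewrite (eq_bigr (fun l : 'I_k => (iter l f s).1)) => [s1|l _]; last first.
      by rewrite nth_traject.
    rewrite (eq_bigr (fun l : 'I_k => (iter l f s).2)) => [s2|l _]; last first.
      by rewrite nth_traject.
    case: r => [|[|//]] _.
      rewrite (eq_bigr (fun l : 'I_k => (iter l f s).1)) // => l _.
      by rewrite /d /trop_orbit addn0 odd_double doubleK.
    rewrite (eq_bigr (fun l : 'I_k => (iter l f s).2)) // => l _.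
    by rewrite /d /trop_orbit addn1 /= odd_double uphalf_double.
case: a0 b0 main => -[] // main _.
(* Initial degrees for which no two terms a_n and x_(n+1) ever balance. *)
- exists (1, 2), 8%N; by apply: main; rewrite ?unlock; vm_compute.
- exists (-1, 1), 8%N; by apply: main; rewrite ?unlock; vm_compute.
- exists (1, 2), 5%N; by apply: main; rewrite ?unlock; vm_compute.
Qed.

Lemma sum_periodic_gt0 (g : nat -> int) (k m : nat) : (0 < m)%N ->
  (forall l, g (l + k)%N = g l) -> 0 < \sum_(l < k) g l ->
  0 < \sum_(l < (m * k)%N) g l.
Proof.
move=> m0 per pos; have [j ->] : exists j, m = j.+1 by exists m.-1; lia.
elim: j => [|j IHj]; first by rewrite mul1n.
rewrite mulSn big_split_ord /= addr_gt0 //.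
by under eq_bigr do rewrite addnC per.
Qed.

(** * The orbit as rational functions *)

Section FractionOrbit.
Variables (F : fieldType) (e : nat -> F) (s0 s1 : {poly F} * {poly F}).

(** Two consecutive fractions are carried as numerator and denominator, with no cancellation of
    common factors. *)
Fixpoint orbit_pair n : ({poly F} * {poly F}) * ({poly F} * {poly F}) :=
  if n is m.+1 then
    let: (x, y) := orbit_pair m in (y, ((e m *: y.2 + y.1) * x.2, y.2 * x.1))
  else (s0, s1).

Definition orbit_num n := (orbit_pair n).1.1.
Definition orbit_den n := (orbit_pair n).1.2.

Lemma orbit_numSS n :
  orbit_num n.+2 = (e n *: orbit_den n.+1 + orbit_num n.+1) * orbit_den n.
Proof. by rewrite /orbit_num /orbit_den /=; case: (orbit_pair n). Qed.

Lemma orbit_denSS n : orbit_den n.+2 = orbit_den n.+1 * orbit_num n.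
Proof. by rewrite /orbit_num /orbit_den /=; case: (orbit_pair n). Qed.

Lemma size_orbit (a0 b0 : bool) (s : int * int) :
  (forall n, (e n == 0) = if odd n then b0 else a0) ->
  (forall n, trop_orbit a0 b0 s n != 0) ->
  s0.1 != 0 -> s0.2 != 0 -> s1.1 != 0 -> s1.2 != 0 ->
  (size s0.1)%:Z - (size s0.2)%:Z = s.1 -> (size s1.1)%:Z - (size s1.2)%:Z = s.2 ->
  forall n, [/\ orbit_num n != 0, orbit_den n != 0
    & (size (orbit_num n))%:Z - (size (orbit_den n))%:Z = trop_orbit a0 b0 s n].
Proof.
move=> eE d0 n0 m0 n1 m1 d_0 d_1 n.
suff [] : [/\ orbit_num n != 0, orbit_den n != 0
    & (size (orbit_num n))%:Z - (size (orbit_den n))%:Z = trop_orbit a0 b0 s n] /\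
    [/\ orbit_num n.+1 != 0, orbit_den n.+1 != 0
    & (size (orbit_num n.+1))%:Z - (size (orbit_den n.+1))%:Z =
      trop_orbit a0 b0 s n.+1] by [].
elim: n => [|n [[nn dn sn] [nn1 dn1 sn1]]]; first by split.
split=> //; rewrite orbit_numSS orbit_denSS.
have := d0 n.+1; rewrite trop_orbitSS -eE -sn -sn1 => nz.
pose A := e n *: orbit_den n.+1 + orbit_num n.+1.
(* No leading terms cancel: when [e n] is nonzero, [nz] makes the two sizes differ, so the larger
   one survives. *)
have [A0 szA] : A != 0 /\ (size A)%:Z = (size (orbit_den n.+1))%:Z +
   (if e n == 0 then (size (orbit_num n.+1))%:Z - (size (orbit_den n.+1))%:Z else
   Num.max 0 ((size (orbit_num n.+1))%:Z - (size (orbit_den n.+1))%:Z)).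
  rewrite /A -size_poly_gt0; have [->|en] := eqVneq (e n) 0.
    by rewrite scale0r add0r size_poly_gt0 addrC subrK.
  have szD : size (e n *: orbit_den n.+1) = size (orbit_den n.+1) by rewrite size_scale.
  have [lt|le] := ltnP (size (orbit_den n.+1)) (size (orbit_num n.+1)).
    rewrite addrC size_polyDl ?szD //; move: lt.
    by move: (size _) (size _) => x y; clear; lia.
  have lt : (size (orbit_num n.+1) < size (orbit_den n.+1))%N.
    by rewrite ltn_neqAle le andbT; apply: contraNneq nz => ->; rewrite subrr.
  rewrite size_polyDl ?szD //; move: lt.
  by move: (size _) (size _) => x y; clear; lia.
split; rewrite ?mulf_neq0 // !size_mul //.
move: A0 dn dn1 nn szA; rewrite -/A -!size_poly_gt0.
move: (size A) (size (orbit_den n)) (size (orbit_num n)) (size (orbit_den n.+1)) => x y z t.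
by case: ifP => _; move: (size _) => u; clear; lia.
Qed.

End FractionOrbit.

(** * Necessity: specialising the indeterminate *)

(** The only form in which uncountability of the field is used. *)
Definition avoids_countable (F : fieldType) :=
  forall h : nat -> {poly F}, (forall n, h n != 0) ->
  exists u, forall n, (h n).[u] != 0.

Lemma lyness_coefSS (F : fieldType) (a b : F) n :
  lyness_coef a b n.+2 = lyness_coef a b n.
Proof. by rewrite /lyness_coef /= negbK. Qed.

Lemma periodic_coefs (F : closedFieldType) (a b : F) (p : nat) :
  avoids_countable F -> (0 < p)%N -> all_periodic (lyness_solution a b) p ->
  ~~ ((a == 0) && (b == 0)) -> a ^+ 2 = b /\ b ^+ 2 = a.
Proof.
move=> avoid p0 per ab0.
have [[t0 t1] [k [d0 dper dpos]]] := trop_cycle ab0.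
pose start (t : int) : {poly F} * {poly F} :=
  if 0 <= t then ('X^(`|t|%N), 1) else (1, 'X^(`|t|%N)).
have start0 t : (start t).1 != 0 /\ (start t).2 != 0.
  by rewrite /start; case: ifP; rewrite /= ?polyXn_eq0 ?oner_eq0 -?size_poly_eq0 ?size_polyXn.
have start_size t : (size (start t).1)%:Z - (size (start t).2)%:Z = t.
  by rewrite /start; case: ifP => t0' /=; rewrite size_polyXn size_poly1; lia.
(* Solutions start at index 1 and orbits at index 0, hence the shift. *)
pose e n := lyness_coef a b n.+1.
pose P := orbit_num e (start t0) (start t1); pose Q := orbit_den e (start t0) (start t1).
have PE n : P n.+2 = (e n *: Q n.+1 + P n.+1) * Q n by apply: orbit_numSS.
have QE n : Q n.+2 = Q n.+1 * P n by apply: orbit_denSS.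
have eE n : (e n == 0) = if odd n then b == 0 else a == 0.
  by rewrite /e /lyness_coef /=; case: odd.
have sz := size_orbit (s0 := start t0) (s1 := start t1) eE d0 (proj1 (start0 t0))
  (proj2 (start0 t0)) (proj1 (start0 t1)) (proj2 (start0 t1)) (start_size t0) (start_size t1).
have P0 n : P n != 0 by case: (sz n).
have Q0 n : Q n != 0 by case: (sz n).
(* [(p * k).*2] is a common period of the solutions and of the degrees. If the identity failed, some
   [u] outside the zeros of [H] and of all [P m], [Q m] would give a genuine solution without period
   [p]. *)
have periodic n : P (n + (p * k).*2)%N * Q n = P n * Q (n + (p * k).*2)%N.
  apply/eqP; rewrite -subr_eq0; set H := (X in X == 0).
  apply/negPn/negP => H0.
  have [u hu] : exists u, forall n, (P n * Q n * H).[u] != 0.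
    by apply: avoid => m; rewrite !mulf_neq0.
  have Pu m : (P m).[u] != 0 by apply: contraNneq (hu m) => h; rewrite !hornerM h !mul0r.
  have Qu m : (Q m).[u] != 0 by apply: contraNneq (hu m) => h; rewrite !hornerM h mulr0 mul0r.
  pose x m := (P m.-1).[u] / (Q m.-1).[u].
  have sol : lyness_solution a b x.
    case=> // m _; split; first by rewrite /x mulf_neq0 ?invr_eq0.
    rewrite /x /= PE QE !hornerE -/(e m).
    by field; rewrite Pu !Qu.
  have xper j : x (n.+1 + j * p)%N = x n.+1.
    by elim: j => [|j IHj]; rewrite ?addn0 // mulSn addnCA addnC per.
  have := xper (k.*2); rewrite /x addSn /=.
  have -> : (k.*2 * p = (p * k).*2)%N by rewrite -!muln2; lia.
  move/eqP; rewrite eqr_div // => /eqP E.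
  have := hu 0%N; rewrite hornerM /H hornerD hornerN !hornerM E.
  by rewrite subrr mulr0 eqxx.
have key r : (r < 2)%N -> e r ^+ 2 = e r.+1.
  move=> r2; apply/eqP/negPn/negP => ne.
  have := degrees_sum_le0 (fun n => lyness_coefSS a b n.+1) ne PE QE P0 Q0 periodic.
  rewrite leNgt => /negP; apply.
  pose g l := trop_orbit (a == 0) (b == 0) (t0, t1) (l.*2 + r)%N.
  rewrite (eq_bigr (fun l : 'I__ => g l)).
    apply: (@sum_periodic_gt0 g) => //.
      by move=> l; rewrite /g doubleD addnAC dper.
    exact: dpos.
  by move=> l _; case: (sz (l.*2 + r)%N).
by split; [have := key 0%N isT|have := key 1%N isT].
Qed.

(** * Sufficiency and minimality of the periods *)

Section Periodic.
Variable F : fieldType.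
Implicit Types (a b : F) (x : nat -> F).

Lemma lyness_shift5 a b x n : a ^+ 2 = b -> b ^+ 2 = a -> a * b = 1 ->
  (0 < n)%N -> lyness_solution a b x -> x (n + 5)%N = lyness_coef a b n.+1 * x n.
Proof.
move=> ab ba ab1 n0 sol; rewrite !addnS addn0.
have [xn0 x2] := sol n n0; have [xn1 x3] := sol n.+1 isT.
have [xn2 x4] := sol n.+2 isT; have [xn3 x5] := sol n.+3 isT.
have : [/\ lyness_coef a b n ^+ 2 = lyness_coef a b n.+1,
       lyness_coef a b n.+1 ^+ 2 = lyness_coef a b n
       & lyness_coef a b n * lyness_coef a b n.+1 = 1].
  by rewrite /lyness_coef /=; case: odd => //=; rewrite [b * _]mulrC.
move: x2 x3 x4 x5; rewrite !lyness_coefSS.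
move: (lyness_coef a b n) (lyness_coef a b n.+1) => c d x2 x3 x4 x5 [cd dc cd1].
have {}x2 : x n.+2 * x n = c + x n.+1 by rewrite x2 divfK.
have {}x3 : x n.+3 * x n.+1 = d + x n.+2 by rewrite x3 divfK.
have {}x4 : x n.+4 * x n.+2 = c + x n.+3 by rewrite x4 divfK.
rewrite x5; apply: (canLR (mulfK xn3)).
move: x2 x3 x4 xn1 xn2 {x5}.
move: (x n) (x n.+1) (x n.+2) (x n.+3) (x n.+4) => s t u p q su tp uq t0 u0.
(* After multiplication by [t * u], the products [u * s], [p * t] and [q * u] can be replaced by the
   recurrence; the rest is a combination of [p * t - (d + u)], [c - d * d] and [1 - c * d]. *)
apply: (mulIf (mulf_neq0 t0 u0)); apply/eqP; rewrite -subr_eq0.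
have -> : (d + q) * (t * u) - d * s * p * (t * u) =
  d * t * u + t * (q * u) - d * (u * s) * (p * t) by ring.
have {}dc : d * d = c by rewrite -expr2.
have tpE : p * t - (d + u) = 0 by rewrite tp subrr.
rewrite su tp uq.
have -> : d * t * u + t * (c + p) - d * (c + t) * (d + u) =
  (p * t - (d + u)) + (c - d * d) * t + (1 - c * d) * (u + d) by ring.
by rewrite tpE dc cd1 !subrr !mul0r !addr0.
Qed.

(** Repeating [s] gives a solution, with [s ++ s] handling the wrap-around. Its first value occurs
    once in [s], so every period is a multiple of [size s]. *)
Lemma period_lower_bound a b (s : seq F) : (1 < size s)%N ->
  (forall n, lyness_coef a b (n + size s) = lyness_coef a b n) ->
  all (fun y => y != 0) s ->
  all (fun i => (s ++ s)`_i.+2 * s`_i == lyness_coef a b i.+1 + (s ++ s)`_i.+1)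
    (iota 0 (size s)) ->
  all (fun y => y != s`_0) (behead s) ->
  forall q, (0 < q)%N -> all_periodic (lyness_solution a b) q -> (size s <= q)%N.
Proof.
move=> s_gt1 coef_per nz rec neq q q0 per.
have s_gt0 := ltnW s_gt1.
have nth_ss m : (m < size s + size s)%N -> (s ++ s)`_m = s`_(m %% size s).
  move=> lt; rewrite nth_cat; case: ltnP => [/modn_small->//|le].
  by rewrite -[in RHS](subnK le) modnDr modn_small // ltn_subLR.
pose x n := s`_(n.-1 %% size s).
have coef_modn n : lyness_coef a b (n %% size s).+1 = lyness_coef a b n.+1.
  rewrite [in RHS](divn_eq n (size s)) addnC -addSn.
  by elim: (n %/ size s)%N => [|k IHk]; rewrite ?addn0 // mulSn addnCA addnC coef_per.
have sol : lyness_solution a b x.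
  case=> // n _; have lt : (n %% size s < size s)%N by rewrite ltn_mod.
  have xn0 : x n.+1 != 0 by rewrite /x /= (allP nz) // mem_nth.
  split=> //; apply: (canRL (mulfK xn0)).
  have /(allP rec)/eqP : (n %% size s)%N \in iota 0 (size s) by rewrite mem_iota.
  have lt2 : ((n %% size s).+2 < size s + size s)%N.
    by have := leq_add lt s_gt1; rewrite addn2.
  rewrite coef_modn nth_ss // nth_ss ?(ltnW lt2) //.
  by rewrite -addn2 -(addn1 (_ %% _)%N) !modnDml addn1 addn2.
have /= := per x sol 1%N isT; rewrite /x /= mod0n => E.
rewrite dvdn_leq //; apply: contraTT (introT eqP E) => ndvd.
have lt : ((q %% size s).-1 < size (behead s))%N.
  by rewrite size_behead -ltnS !prednK ?ltn_mod // lt0n.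
have := allP neq _ (mem_nth 0 lt).
by rewrite nth_behead prednK // lt0n.
Qed.

End Periodic.

Section Cases.
Variable F : numFieldType.

Lemma lyness00_period6 : globally_p_periodic (@lyness_solution F 0 0) 6.
Proof.
split=> // [x sol n n0|].
  have rec m : (0 < m)%N -> x m != 0 /\ x m.+2 = x m.+1 / x m.
    by move=> /sol[? ->]; rewrite /lyness_coef if_same add0r.
  rewrite !addnS addn0.
  have [xn0 x2] := rec n n0; have [xn1 x3] := rec n.+1 isT.
  have [xn2 x4] := rec n.+2 isT; have [xn3 x5] := rec n.+3 isT.
  have [xn4 x6] := rec n.+4 isT.
  by rewrite x6 x5 x4 x3 x2; field; rewrite xn0 xn1.
apply: (@period_lower_bound _ _ _ [:: 3; 2; 2 / 3; 1 / 3; 1 / 2; 3 / 2]) => //.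
- by move=> n; rewrite /lyness_coef !if_same.
- by rewrite /= !(mulf_eq0, invr_eq0, pnatr_eq0, oner_eq0).
- by rewrite /lyness_coef /=; do !(apply/andP; split=> //); apply/eqP; field.
- rewrite /= -!(subr_eq0 _ (3 : F)).
  have -> : 2 - 3 = - 1 :> F by ring.
  have -> : 2 / 3 - 3 = - (7 / 3) :> F by field.
  have -> : 1 / 3 - 3 = - (8 / 3) :> F by field.
  have -> : 1 / 2 - 3 = - (5 / 2) :> F by field.
  have -> : 3 / 2 - 3 = - (3 / 2) :> F by field.
  by rewrite !(oppr_eq0, mulf_eq0, invr_eq0, pnatr_eq0, oner_eq0).
Qed.

Lemma lyness11_period5 : globally_p_periodic (@lyness_solution F 1 1) 5.
Proof.
split=> // [x sol n n0|].
  by rewrite (lyness_shift5 _ _ _ n0 sol) ?expr1n ?mulr1 // /lyness_coef if_same mul1r.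
apply: (@period_lower_bound _ _ _ [:: 1; 3; 4; 5 / 3; 2 / 3]) => //.
- by move=> n; rewrite /lyness_coef !if_same.
- by rewrite /= !(mulf_eq0, invr_eq0, pnatr_eq0, oner_eq0).
- by rewrite /lyness_coef /=; do !(apply/andP; split=> //); apply/eqP; field.
- rewrite /= -!(subr_eq0 _ (1 : F)).
  have -> : 3 - 1 = 2 :> F by ring.
  have -> : 4 - 1 = 3 :> F by ring.
  have -> : 5 / 3 - 1 = 2 / 3 :> F by field.
  have -> : 2 / 3 - 1 = - (1 / 3) :> F by field.
  by rewrite !(oppr_eq0, mulf_eq0, invr_eq0, pnatr_eq0, oner_eq0).
Qed.

Lemma lyness_cubic_root_period10 (a : F) : a ^+ 2 + a + 1 = 0 ->
  globally_p_periodic (lyness_solution a (a ^+ 2)) 10.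
Proof.
move=> a_root; set b := a ^+ 2.
have bE : b = - a - 1 by apply/eqP; rewrite -subr_eq0 -a_root /b; apply/eqP; ring.
have ab1 : a * b = 1.
  by apply/eqP; rewrite -subr_eq0 -(mulr0 (a - 1)) -a_root /b; apply/eqP; ring.
have ba : b ^+ 2 = a by rewrite expr2 {1}/b expr2 -mulrA ab1 mulr1.
have sq : a ^+ 2 = b by [].
clearbody b.
split=> // [x sol n n0|].
  have shift m m0 := @lyness_shift5 _ a b x m sq ba ab1 m0 sol.
  rewrite (addnA n 5 5) !shift ?addn_gt0 ?n0 // mulrA addnC -addnS.
  have -> : lyness_coef a b (5 + n.+1) * lyness_coef a b n.+1 = 1.
    by rewrite /lyness_coef /=; case: odd; rewrite // mulrC.
  by rewrite mul1r.
(* Characteristic 0 rules out coincidences: [a = 1], [a = 2], [a = -1] or [2 * a = 1] would make a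
   multiple of [a ^+ 2 + a + 1] equal to 3, 7, 1 or 7. *)
have nz (m : nat) (y : F) : (0 < m)%N -> m%:R = y * (a ^+ 2 + a + 1) -> False.
  by move=> m0 /eqP; rewrite a_root mulr0 pnatr_eq0; case: m m0.
have a0 : a != 0 by apply: contra_eq_neq ab1 => ->; rewrite mul0r eq_sym oner_eq0.
have b0 : b != 0 by rewrite -sq expf_neq0.
have a_neq1 : a != 1.
  by apply/eqP => a1; apply: (nz 3 1) => //; rewrite a1; ring.
have a_neq2 : a != 2.
  by apply/eqP => a2; apply: (nz 7 1) => //; rewrite a2; ring.
have b_neq1 : b != 1 by apply: contra_neq a_neq1 => b1; rewrite -ba b1 expr1n.
have two0 : 2 != 0 :> F by rewrite pnatr_eq0.
(* The orbit of [x_1 = 1], [x_2 = -1]; by [lyness_shift5] the second half is the first one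
   multiplied alternately by [b] and [a]. *)
apply: (@period_lower_bound _ _ _ [:: 1; -1; a - 1; 2; b; b; - a; 1 - b; 2 * a; a]) => //.
- by move=> n; rewrite !addnS addn0 !lyness_coefSS.
- by rewrite /= !oppr_eq0 !subr_eq0 mulf_eq0 !(negPf a0) !(negPf b0) (negPf two0)
    oner_eq0 (negPf a_neq1) (eq_sym 1) (negPf b_neq1).
- rewrite /lyness_coef /=; do !(apply/andP; split=> //); apply/eqP.
  + by ring.
  + by rewrite bE; ring.
  + by rewrite mulrBr (mulrC b) ab1 bE; ring.
  + by ring.
  + by rewrite mulNr ab1 bE; ring.
  + by rewrite mulrBl -expr2 ba; ring.
  + by rewrite mulrN -mulrA -expr2 sq bE; ring.
  + by rewrite mulrBr ab1 bE; ring.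
  + by ring.
  + by rewrite bE; ring.
- rewrite /= (negPf b_neq1) (negPf a_neq1).
  have -> : a - 1 == 1 = (a == 2) by rewrite subr_eq.
  rewrite (negPf a_neq2) /=; apply/and5P; split.
  + by rewrite eq_sym -subr_eq0 opprK -[1 + 1]/2%:R.
  + by rewrite -subr_eq0 -[2]/(1 + 1) addrK oner_eq0.
  + by apply/eqP => a1; apply: (nz 1 1) => //; rewrite -[a]opprK a1; ring.
  + by rewrite -subr_eq0 addrAC subrr sub0r oppr_eq0.
  + rewrite andbT; apply/eqP => a1; apply: (nz 7 4) => //.
    have -> : 4 * (a ^+ 2 + a + 1) = (2 * a) ^+ 2 + 2 * (2 * a) + 4 by ring.
    by rewrite a1; ring.
Qed.

End Cases.

(** * The complex field and primitive cube roots of unity *)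

(** Real values suffice: the real roots of all the [h k] form a countable set, of measure 0, which
    cannot cover the unit interval. *)
Lemma complex_avoids (R : realType) : avoids_countable R[i].
Proof.
move=> h h0; apply: contrapT => /forallNP none.
pose B := (\bigcup_k [set r : R | root (h k) r%:C%C])%classic.
have cB : countable B.
  apply: bigcup_countable => // k _; apply: finite_set_countable.
  have [rs Ers] := closed_field_poly_normal (h k).
  have -> : [set r : R | root (h k) r%:C%C]%classic =
      ((fun r : R => r%:C%C) @^-1` [set` rs])%classic.
    by apply/seteqP; split=> r /=;
      rewrite Ers rootZ ?lead_coef_eq0 // root_prod_XsubC.
  apply: finite_preimage => [x y _ _ /complexI -> //|]; exact: finite_seq.
have : lebesgue_measure (`[0%R, 1%R]%classic : set R) = 0%E.
  apply: countable_lebesgue_measure0; apply: sub_countable cB.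
  apply: subset_card_le => r _.
  have /existsNP[k /negP/negPn hk] := none r%:C%C.
  by exists k.
rewrite lebesgue_measure_itv /= lte_fin ltr01 -EFinB subr0 => /eqP.
by rewrite eqe oner_eq0.
Qed.

Lemma cubic_rootsE (C : numClosedFieldType) (a : C) :
  (a ^+ 2 + a + 1 == 0) =
  (a == (-1 + 'i * sqrtC 3) / 2) || (a == (-1 - 'i * sqrtC 3) / 2).
Proof.
have -> : a ^+ 2 + a + 1 =
    (a - (-1 + 'i * sqrtC 3) / 2) * (a - (-1 - 'i * sqrtC 3) / 2).
  have i2 : 'i * 'i = -1 :> C by rewrite -expr2 sqrCi.
  have s2 : sqrtC 3 * sqrtC 3 = 3 :> C by rewrite -expr2 sqrtCK.
  have -> : (a - (-1 + 'i * sqrtC 3) / 2) * (a - (-1 - 'i * sqrtC 3) / 2) =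
    a ^+ 2 + a + (1 - ('i * 'i) * (sqrtC 3 * sqrtC 3)) / 4 by field.
  by rewrite i2 s2; field.
by rewrite mulf_eq0 !subr_eq0.
Qed.

(** Conjugation exchanges the two roots, and [a ^+ 2 = - a - 1] is the root other than [a]. *)
Lemma cubic_root_conj (C : numClosedFieldType) (a : C) :
  a ^+ 2 + a + 1 = 0 -> a^* = a ^+ 2.
Proof.
move=> a_root.
have -> : a ^+ 2 = - a - 1.
  by apply/eqP; rewrite -subr_eq0 -a_root; apply/eqP; ring.
have s3 : (sqrtC 3)^* = sqrtC 3 :> C.
  by apply: geC0_conj; rewrite sqrtC_ge0 ler0n.
move/eqP: a_root; rewrite cubic_rootsE => /orP[]/eqP->;
  by rewrite !(rmorphM, rmorphD, rmorphN, rmorph1, fmorphV, rmorph_nat) /= conjCi s3; field.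
Qed.

Theorem theorem7 (R : realType) :
  [/\ globally_p_periodic (@lyness_solution R[i] 0 0) 6,
      globally_p_periodic (@lyness_solution R[i] 1 1) 5,
      (forall a : R[i],
         a = (-1 + 'i * sqrtC 3) / 2 \/ a = (-1 - 'i * sqrtC 3) / 2 ->
         Num.conj a = 1 / a /\
         globally_p_periodic (lyness_solution a (Num.conj a)) 10)
    & forall a b : R[i],
        globally_periodic (lyness_solution a b) ->
        [\/ a = 0 /\ b = 0,
            a = 1 /\ b = 1
          | (a = (-1 + 'i * sqrtC 3) / 2 \/ a = (-1 - 'i * sqrtC 3) / 2) /\
            b = Num.conj a]].
Proof.
split; [exact: lyness00_period6|exact: lyness11_period5|move=> a aE|move=> a b].
  have a_root : a ^+ 2 + a + 1 = 0.
    by apply/eqP; rewrite cubic_rootsE; case: aE => /eqP->; rewrite ?orbT.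
  have a0 : a != 0.
    by apply: contra_eq_neq a_root => ->; rewrite expr0n !add0r oner_eq0.
  rewrite cubic_root_conj //; split; last exact: lyness_cubic_root_period10.
  apply: (canRL (mulfK a0)); apply/eqP; rewrite -subr_eq0.
  by rewrite -(mulr0 (a - 1)) -a_root; apply/eqP; ring.
case=> p [p0 per _].
have [/andP[/eqP-> /eqP->]|ab0] := boolP ((a == 0) && (b == 0)); first by constructor 1.
have [ab ba] := periodic_coefs (@complex_avoids R) p0 per ab0.
have a0 : a != 0 by apply: contraNneq ab0 => a0; rewrite -ab a0 expr0n !eqxx.
(* Combining [a ^+ 2 = b] with [b ^+ 2 = a] gives [a ^+ 4 = a], which factors. *)
have /eqP : a * ((a - 1) * (a ^+ 2 + a + 1)) = 0.
  by have <- : a ^+ 2 ^+ 2 - a = 0 by [rewrite ab ba subrr]; ring.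
rewrite mulf_eq0 (negPf a0) mulf_eq0 subr_eq0 /= => /orP[/eqP a1|].
  by constructor 2; rewrite -ab a1 expr1n.
move=> a_root; constructor 3; split; last by rewrite -ab cubic_root_conj //; apply/eqP.
by move: a_root; rewrite cubic_rootsE => /orP[]/eqP; [left|right].
Qed.
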